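(* Let $P,\sigma_n^2,l_A,l_B,l_E>0$ be fixed real constants. For integers $M,N\ge 1$ define $$\eta(N)=N-\frac{2}{\pi^2}(N-1)+\frac{2N}{\pi^2}(\ln N+a),$$ where $a$ is Euler's constant, and $$\underline{R}_S(M,N)=\log_2\left(1+\frac{l_Al_BMN^2P}{\sigma_n^2}\right)-\log_2\left(1+\frac{l_Al_EMP}{\sigma_n^2}\,\eta(N)\right).$$ Then, as $N\to\infty$ and $M\to\infty$, $$\underline{R}_S(M,N)-\log_2\left(\frac{N^2l_B}{\eta(N)\,l_E}\right)\to 0 \quad\text{and}\quad \log_2\left(\frac{N^2l_B}{\eta(N)\,l_E}\right)-\log_2\left(\frac{N\pi^2l_B}{2\,l_E\ln N}\right)\to 0 .$$
   Context: Euler's constant is $a=\lim_{n\to\infty}\left[\sum_{k=1}^{n-1}\frac1k-\ln n\right]$. The quantity $\underline{R}_S(M,N)$ is a lower bound for the ergodic achievable secrecy rate of a wiretap channel assisted by a reconfigurable intelligent surface with $N$ reflecting elements. The transmitter has $M$ antennas, transmit power $P$, and noise power $\sigma_n^2$. The large-scale fadings are $l_A$ (transmitter–surface), $l_B$ (surface–legitimate receiver) and $l_E$ (surface–eavesdropper). *)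

(* Defs.v *)
From Stdlib Require Import Reals Lra Lia.
From Coquelicot Require Import Coquelicot.
Open Scope R_scope.

(* [sum_n_m u 1 (n - 1)] is the empty sum, hence 0, for n <= 1. *)
Definition euler_seq (n : nat) : R :=
  sum_n_m (fun k : nat => 1 / INR k) 1 (n - 1) - ln (INR n).

Definition euler_constant : R := real (Lim_seq euler_seq).

Lemma ln_le_sub1 (x : R) : 0 < x -> ln x <= x - 1.
Proof.
  intros Hx. pose proof (exp_ineq1_le (ln x)) as H.
  rewrite exp_ln in H by exact Hx. lra.
Qed.

Lemma euler_seq_S (n : nat) : (1 <= n)%nat ->
  euler_seq (S n) = euler_seq n + 1 / INR n - (ln (INR n + 1) - ln (INR n)).
Proof.
  intros Hn. unfold euler_seq.
  replace (S n - 1)%nat with (S (n - 1)) by lia.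
  rewrite sum_n_Sm by lia. change plus with Rplus.
  replace (S (n - 1)) with n by lia. rewrite S_INR. ring.
Qed.

(* [Lim_seq] is total and [real] sends infinities to 0: this lemma shows that
   [euler_constant] is the genuine limit. *)
Lemma is_lim_seq_euler : is_lim_seq euler_seq euler_constant.
Proof.
  apply Lim_seq_correct'.
  assert (H01 : euler_seq 0 = 0 /\ euler_seq 1 = 0).
  { assert (Hs : sum_n_m (fun k : nat => 1 / INR k) 1 0 = 0)
      by (apply (sum_n_m_zero (G := R_AbelianMonoid)); lia).
    unfold euler_seq. change (0 - 1)%nat with 0%nat.
    change (1 - 1)%nat with 0%nat. rewrite Hs. simpl. split.
    - unfold ln. destruct (Rlt_dec 0 0) as [H|_]; [destruct (Rlt_irrefl 0 H)|apply Rminus_diag].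
    - rewrite ln_1. lra. }
  destruct H01 as [H0 H1].
  apply (ex_finite_lim_seq_incr _ 1).
  - intros [|n]; [lra|].
    rewrite (euler_seq_S (S n)) by lia.
    pose proof (lt_0_INR (S n) ltac:(lia)) as Hx.
    set (x := INR (S n)) in *.
    assert (H : ln ((x + 1) / x) <= (x + 1) / x - 1)
      by (apply ln_le_sub1, Rdiv_lt_0_compat; lra).
    rewrite ln_div in H by lra.
    replace ((x + 1) / x - 1) with (1 / x) in H by (field; lra). lra.
  - assert (Hb : forall n, euler_seq (S n) <= 1 - 1 / INR (S n)).
    { induction n as [|n IH].
      - rewrite H1. simpl. lra.
      - rewrite (euler_seq_S (S n)) by lia.
        rewrite (S_INR (S n)).
        pose proof (lt_0_INR (S n) ltac:(lia)) as Hx.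
        set (x := INR (S n)) in *.
        assert (H : ln (x / (x + 1)) <= x / (x + 1) - 1)
          by (apply ln_le_sub1, Rdiv_lt_0_compat; lra).
        rewrite ln_div in H by lra.
        replace (x / (x + 1) - 1) with (- (1 / (x + 1))) in H by (field; lra).
        lra. }
    intros [|n]; [lra|].
    pose proof (lt_0_INR (S n) ltac:(lia)) as Hx.
    assert (0 < 1 / INR (S n)) by (apply Rdiv_lt_0_compat; lra).
    specialize (Hb n). lra.
Qed.

Definition log2 (x : R) : R := ln x / ln 2.

Definition eta (N : nat) : R :=
  INR N - 2 / PI ^ 2 * (INR N - 1)
  + 2 * INR N / PI ^ 2 * (ln (INR N) + euler_constant).

(* [sigma2] is the noise power sigma_n^2. *)
Definition R_S_lower (P sigma2 lA lB lE : R) (M N : nat) : R :=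
  log2 (1 + lA * lB * INR M * INR N ^ 2 * P / sigma2)
  - log2 (1 + lA * lE * INR M * P / sigma2 * eta N).

(* Main.v *)
Require Import Defs.
From Stdlib Require Import Reals Lra.
From Coquelicot Require Import Coquelicot.
Open Scope R_scope.

(** Write [x] and [y] for the two signal-to-noise ratios in [R_S_lower]. Their
    quotient is exactly [N^2 lB / (eta N * lE)], so the first difference equals
    [log2 (1 + 1/x) - log2 (1 + 1/y)], and both [x] and [y] tend to infinity.
    The second difference is the [log2] of [2 / PI^2] divided by
    [eta N / (N ln N)], whose limit is [2 / PI^2]. *)

Lemma is_lim_seq_p_infty_gt (u : nat -> R) (c : R) :
  is_lim_seq u p_infty -> eventually (fun n => c < u n).
Proof.
  intros H. apply is_lim_seq_spec in H. exact (H c).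
Qed.

Lemma is_lim_seq_inv_p_infty (u : nat -> R) :
  is_lim_seq u p_infty -> is_lim_seq (fun n => / u n) 0.
Proof.
  intros H. apply (is_lim_seq_inv u p_infty H). discriminate.
Qed.

Lemma is_lim_seq_ln_INR : is_lim_seq (fun n => ln (INR n)) p_infty.
Proof.
  apply (is_lim_comp_seq ln INR p_infty p_infty is_lim_ln_p).
  (* The side condition asks that [INR n] eventually differ from [p_infty], as every real value
     does. *)
  - exists 0%nat. discriminate.
  - exact is_lim_seq_INR.
Qed.

Lemma is_lim_seq_INR_mult_ln : is_lim_seq (fun n => INR n * ln (INR n)) p_infty.
Proof.
  apply (is_lim_seq_mult _ _ p_infty p_infty); [| |reflexivity].
  - exact is_lim_seq_INR.
  - exact is_lim_seq_ln_INR.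
Qed.

Lemma two_div_PI2_gt0 : 0 < 2 / PI ^ 2.
Proof.
  apply Rdiv_lt_0_compat; [lra|apply pow_lt, PI_RGT_0].
Qed.

(** With [q = 2 / PI ^ 2] and [a] Euler's constant, [eta N] regroups as
    [(1 - q + q * a) * N + q + q * N * ln N]; only the last term survives division by [N * ln N]. *)
Lemma is_lim_seq_eta_div :
  is_lim_seq (fun N => eta N / (INR N * ln (INR N))) (2 / PI ^ 2).
Proof.
  pose proof PI_RGT_0.
  set (q := 2 / PI ^ 2).
  apply is_lim_seq_ext_loc with
    (fun N => (1 - q + q * euler_constant) * / ln (INR N)
              + q * / (INR N * ln (INR N)) + q).
  - pose proof (is_lim_seq_p_infty_gt _ 0 is_lim_seq_ln_INR) as Hln.
    pose proof (is_lim_seq_p_infty_gt _ 0 is_lim_seq_INR) as HN.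
    generalize (filter_and _ _ Hln HN). apply filter_imp.
    intros n [H1 H2]. unfold eta, q. field. repeat split; lra.
  - replace (Finite q) with
      (Finite ((1 - q + q * euler_constant) * 0 + q * 0 + q)) by (f_equal; ring).
    repeat apply is_lim_seq_plus'; try apply is_lim_seq_mult';
      try apply is_lim_seq_const; apply is_lim_seq_inv_p_infty.
    + exact is_lim_seq_ln_INR.
    + exact is_lim_seq_INR_mult_ln.
Qed.

(** A ratio with positive limit times [N * ln N]. Besides the divergence, this yields the eventual
    positivity of [eta], which the logarithm rules require. *)
Lemma is_lim_seq_eta : is_lim_seq eta p_infty.
Proof.
  apply is_lim_seq_ext_loc with
    (fun N => eta N / (INR N * ln (INR N)) * (INR N * ln (INR N))).
  - generalize (is_lim_seq_p_infty_gt _ 0 is_lim_seq_INR_mult_ln).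
    apply filter_imp. intros n H. unfold Rdiv.
    rewrite Rmult_assoc, Rinv_l; lra.
  - apply (is_lim_seq_mult _ _ _ _ _ is_lim_seq_eta_div is_lim_seq_INR_mult_ln).
    apply is_Rbar_mult_sym, is_Rbar_mult_p_infty_pos. exact two_div_PI2_gt0.
Qed.

Lemma log2_1 : log2 1 = 0.
Proof. unfold log2. rewrite ln_1. apply Rdiv_0_l. Qed.

Lemma log2_div (x y : R) : 0 < x -> 0 < y -> log2 (x / y) = log2 x - log2 y.
Proof.
  intros Hx Hy. unfold log2. rewrite ln_div by assumption. unfold Rdiv; ring.
Qed.

Lemma continuous_log2 (x : R) : 0 < x -> continuous log2 x.
Proof.
  intros Hx. apply (continuous_mult ln (fun _ => / ln 2)).
  - now apply continuous_ln.
  - apply continuous_const.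
Qed.

(** Both reciprocal signal-to-noise ratios are a constant times a null sequence in [M] times a null
    sequence in [N]. Such a product vanishes along the product filter, with no relation between the
    growth of [M] and [N], and [log2] is continuous at 1. *)
Lemma filterlim_log2_1p (c : R) (u v : nat -> R) :
  is_lim_seq u 0 -> is_lim_seq v 0 ->
  filterlim (fun p : nat * nat => log2 (1 + c * (u (fst p) * v (snd p))))
    (filter_prod eventually eventually) (locally 0).
Proof.
  intros Hu Hv.
  apply (filterlim_comp _ _ _ (fun p : nat * nat => u (fst p) * v (snd p))
           (fun z => log2 (1 + c * z)) _ (locally 0)).
  - apply (filterlim_comp_2 (fun p : nat * nat => u (fst p))
             (fun p : nat * nat => v (snd p)) Rmult
             (G := locally 0) (H := locally 0)).
    + apply (filterlim_comp _ _ _ fst u _ eventually); [apply filterlim_fst|exact Hu].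
    + apply (filterlim_comp _ _ _ snd v _ eventually); [apply filterlim_snd|exact Hv].
    (* The third 0 is the target of the limit, put in the form [0 * 0]. *)
    + rewrite <- (Rmult_0_l 0) at 3. apply (filterlim_mult (K := R_AbsRing) 0 0).
  - replace (locally 0) with (locally (log2 (1 + c * 0))) at 2
      by (rewrite Rmult_0_r, Rplus_0_r, log2_1; reflexivity).
    apply (continuous_comp (fun z => 1 + c * z) log2).
    + apply (continuous_plus (fun _ => 1) (fun z => c * z)).
      * apply continuous_const.
      * apply (continuous_mult (fun _ => c) (fun z => z)).
        -- apply continuous_const.
        -- apply continuous_id.
    + apply continuous_log2. lra.
Qed.

(** Factor [1 + x = x * (1 + / x)], and likewise for [y]; the logarithms of [x] and [y] cancel
    against that of the quotient. *)
Lemma log2_1p_sub_ratio (x y : R) : 0 < x -> 0 < y ->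
  log2 (1 + x) - log2 (1 + y) - log2 (x / y) = log2 (1 + / x) - log2 (1 + / y).
Proof.
  intros Hx Hy.
  replace (1 + / x) with ((1 + x) / x) by (field; lra).
  replace (1 + / y) with ((1 + y) / y) by (field; lra).
  rewrite !log2_div by lra. ring.
Qed.

Theorem mainTheorem2 (P sigma2 lA lB lE : R)
  (hP : 0 < P) (hsigma2 : 0 < sigma2)
  (hlA : 0 < lA) (hlB : 0 < lB) (hlE : 0 < lE) :
  filterlim
    (fun MN : nat * nat =>
       R_S_lower P sigma2 lA lB lE (fst MN) (snd MN)
       - log2 (INR (snd MN) ^ 2 * lB / (eta (snd MN) * lE)))
    (filter_prod eventually eventually) (locally 0)
  /\
  is_lim_seq
    (fun N : nat =>
       log2 (INR N ^ 2 * lB / (eta N * lE))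
       - log2 (INR N * PI ^ 2 * lB / (2 * lE * ln (INR N))))
    0.
Proof.
  pose proof (is_lim_seq_p_infty_gt _ 0 is_lim_seq_INR) as HN.
  pose proof (is_lim_seq_p_infty_gt _ 0 is_lim_seq_eta) as Heta.
  split.
  (* These constants make the reciprocal ratios [b / (M * N ^ 2)] and [e / (M * eta N)]. *)
  - set (b := sigma2 / (lA * lB * P)).
    set (e := sigma2 / (lA * lE * P)).
    assert (HM : is_lim_seq (fun n => / INR n) 0)
      by (apply is_lim_seq_inv_p_infty, is_lim_seq_INR).
    apply filterlim_ext_loc with
      (fun p : nat * nat =>
         log2 (1 + b * (/ INR (fst p) * (/ INR (snd p) * / INR (snd p))))
         - log2 (1 + e * (/ INR (fst p) * / eta (snd p)))).
    + apply Filter_prod with (1 := HN) (2 := filter_and _ _ HN Heta).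
      intros M N H0 [H1 H2]. cbn [fst snd].
      set (x := lA * lB * INR M * INR N ^ 2 * P / sigma2).
      set (y := lA * lE * INR M * P / sigma2 * eta N).
      assert (Hx : 0 < x).
      { apply Rdiv_lt_0_compat; [|assumption].
        repeat apply Rmult_lt_0_compat; lra. }
      assert (Hy : 0 < y).
      { apply Rmult_lt_0_compat; [|assumption].
        apply Rdiv_lt_0_compat; [|assumption].
        repeat apply Rmult_lt_0_compat; lra. }
      unfold R_S_lower. fold x y.
      (* The common factor [lA * M * P / sigma2] cancels, so the quotient does not depend on [M]. *)
      replace (INR N ^ 2 * lB / (eta N * lE)) with (x / y)
        by (unfold x, y; field; repeat split; lra).
      rewrite log2_1p_sub_ratio by assumption.
      f_equal; [|f_equal]; f_equal; f_equal; unfold b, e, x, y; field;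
        repeat split; lra.
    + replace (locally 0) with (locally (0 - 0)) by (f_equal; ring).
      apply (filterlim_comp_2 (G := locally 0) (H := locally 0)).
      * apply (filterlim_log2_1p b (fun n => / INR n) (fun n => / INR n * / INR n));
          [exact HM|].
        replace (Finite 0) with (Finite (0 * 0)) by (f_equal; ring).
        now apply is_lim_seq_mult'.
      * apply (filterlim_log2_1p e (fun n => / INR n) (fun n => / eta n));
          [exact HM|apply is_lim_seq_inv_p_infty, is_lim_seq_eta].
      * apply (filterlim_comp_2 fst (fun z => - snd z) Rplus
                 (G := locally 0) (H := locally (- 0))).
        -- apply filterlim_fst.
        -- apply (filterlim_comp _ _ _ snd Ropp _ (locally 0));
             [apply filterlim_snd|apply (filterlim_opp (V := R_NormedModule) 0)].
        -- apply (filterlim_plus (V := R_NormedModule) 0 (- 0)).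
  - pose proof (is_lim_seq_p_infty_gt _ 0 is_lim_seq_ln_INR) as Hln.
    pose proof two_div_PI2_gt0 as Hq. pose proof PI_RGT_0 as HPI.
    apply is_lim_seq_ext_loc with
      (fun N => log2 (2 / PI ^ 2) - log2 (eta N / (INR N * ln (INR N)))).
    + generalize (filter_and _ _ HN (filter_and _ _ Heta Hln)). apply filter_imp.
      intros N (H1 & H2 & H3).
      pose proof (pow_lt PI 2 HPI).
      (* [PI] unfolds to a product, which would mislead [Rmult_lt_0_compat]. *)
      set (pp := PI ^ 2) in *. clearbody pp.
      (* Merging each difference into one logarithm leaves equal arguments, both
         [2 * N * ln N / (PI ^ 2 * eta N)]; the other goals are positivity conditions. *)
      rewrite <- !log2_div.
      * f_equal. field. repeat split; lra.
      * apply Rdiv_lt_0_compat; repeat apply Rmult_lt_0_compat; lra.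
      * apply Rdiv_lt_0_compat; repeat apply Rmult_lt_0_compat; lra.
      * exact Hq.
      * apply Rdiv_lt_0_compat; [lra|now apply Rmult_lt_0_compat].
    + replace (Finite 0) with (Finite (log2 (2 / PI ^ 2) - log2 (2 / PI ^ 2)))
        by (f_equal; ring).
      apply is_lim_seq_minus'; [apply is_lim_seq_const|].
      (* The limit [2 / PI ^ 2] is positive, hence a point of continuity of [log2]. *)
      apply is_lim_seq_continuous; [|exact is_lim_seq_eta_div].
      now apply continuity_pt_filterlim, continuous_log2.
Qed.
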